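(* Let $\Gamma=(\mathbb V,E)$ be a connected graph with countably infinite vertex set, with $M_\Gamma:=\sup_{x\in\mathbb V}\deg(x)<\infty$, and let $H$ be a Jacobi operator on $\Gamma$ (as defined in the context). For a nonempty finite $A\subset\mathbb V$ let $H_A$ be the Dirichlet restriction of $H$ to $A$, $\lambda_A>0$ its smallest eigenvalue, and $u_A$ its landscape function. Suppose that there are constants $C_U$ and $z$ with $$\#\{y\in\mathbb V: d(x,y)\le r\}\le C_U r^{z}\qquad\text{for all }x\in\mathbb V,\ r\in\mathbb N=\{1,2,\dots\},$$ and that there are constants $c_1,\dots,c_5>0$, depending only on $\Gamma$ and not on $A$, such that for every nonempty finite $A\subset\mathbb V$, all $t>0$ and all $x,y\in A$, $$\langle x|e^{-tH_A}|y\rangle\le\begin{cases}c_1t^{-z/2}\exp(-c_2d(x,y)^2/t), & d(x,y)\ge1\text{ and }t\ge d(x,y),\\ c_3\exp(-c_4d(x,y)), & d(x,y)\ge1\text{ and }t<d(x,y),\\ c_5t^{-z/2}, & x=y,\end{cases}$$ with the same exponent $z$. Then there is a constant $C<\infty$ depending only on $C_U,z,M_\Gamma$ and $c_1,\dots,c_5$ such that for every nonempty finite $A\subset\mathbb V$, $$1\le\lambda_A\|u_A\|_{\ell^\infty(A)}\le C.$$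
   Context: Graphs are simple (no loops or multiple edges) and unweighted; $x\sim y$ means $\{x,y\}\in E$; $\deg(x)=\#\{y:y\sim x\}$; $d(x,y)$ is the length of a shortest path. Jacobi operator: for $f:\mathbb V\to\mathbb R$, $$Hf(x)=\frac1{\deg(x)}\sum_{y:y\sim x}\big(f(x)-a(x,y)f(y)\big)+V(x)f(x),$$ where $V:\mathbb V\to[0,\infty)$, and $a(x,y)=a(y,x)\in[0,1]$ if $x\sim y$, $a(x,y)=0$ otherwise. Dirichlet restriction: for $x\in A$ and $f:A\to\mathbb R$, $H_Af(x)=f(x)-\frac1{\deg(x)}\sum_{y\in A:\,y\sim x}a(x,y)f(y)+V(x)f(x)$, with $\deg(x)$ the degree in the full graph $\Gamma$. For finite nonempty $A$, $H_A$ is self-adjoint and strictly positive on $\ell^2(A)$ with the weighted inner product $(f,g)_\mu=\sum_{x\in A}f(x)g(x)\deg(x)$. The landscape function $u_A:A\to\mathbb R$ is the unique solution of $H_Au_A(x)=1$ for all $x\in A$. Matrix elements: $\langle x|L|y\rangle=(L\mathbf 1_y)(x)$, where $\mathbf 1_y$ is the indicator function of $\{y\}$. *)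

(* Defs.v *)
From HB Require Import structures.
From mathcomp Require Import all_boot all_order all_algebra.
From mathcomp Require Import finmap.
From mathcomp Require Import all_classical all_reals all_analysis.
Set Implicit Arguments.
Unset Strict Implicit.
Unset Printing Implicit Defensive.
Import Order.TTheory GRing.Theory Num.Theory.
Import numFieldNormedType.Exports.
Local Open Scope classical_set_scope.
Local Open Scope ring_scope.

(* A simple graph on [V] is a symmetric irreflexive [e : rel V]. *)
Definition has_walk (V : choiceType) (e : rel V) (x y : V) (n : nat) : Prop :=
  exists p : seq V, [/\ path e x p, last x p = y & size p = n].

Definition connected_graph (V : choiceType) (e : rel V) : Prop :=
  forall x y : V, exists n, has_walk e x y n.

(* The default value 0 is only reached when no path joins [x] to [y]. *)
Definition gdist (V : choiceType) (e : rel V) (x y : V) : nat :=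
  xget 0%N [set n | has_walk e x y n /\ forall m, has_walk e x y m -> (n <= m)%N].

Definition nbhd_set (V : choiceType) (e : rel V) (x : V) : set V :=
  [set y | e x y].

(* Meaningful for vertices with finitely many neighbours only, as [fset_set]
   sends infinite sets to the empty one. *)
Definition deg (V : choiceType) (e : rel V) (x : V) : nat :=
  #|` fset_set (nbhd_set e x)|%fset.

(* Degrees are counted in the extended reals here (an infinite neighbourhood
   counts +oo), so a finite supremum includes local finiteness. *)
Definition sup_deg (R : realType) (V : choiceType) (e : rel V) : \bar R :=
  ereal_sup (range (fun x : V => counting (nbhd_set e x) : \bar R)).

(* A Jacobi operator is given by its coefficients [a] and its potential [q]. *)
Definition jacobi_coeffs (R : realType) (V : choiceType) (e : rel V)
    (a : V -> V -> R) (q : V -> R) : Prop :=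
  [/\ forall x, 0 <= q x,
      forall x y, a x y = a y x,
      forall x y, e x y -> 0 <= a x y <= 1
    & forall x y, ~~ e x y -> a x y = 0].

Definition jacobi (R : realType) (V : choiceType) (e : rel V)
    (a : V -> V -> R) (q : V -> R) (f : V -> R) (x : V) : R :=
  (deg e x)%:R^-1 * (\sum_(y <- fset_set (nbhd_set e x)) (f x - a x y * f y))
  + q x * f x.

Definition dirichlet (R : realType) (V : choiceType) (e : rel V)
    (a : V -> V -> R) (q : V -> R) (A : {fset V}) (f : A -> R) (x : A) : R :=
  f x
  - (deg e (val x))%:R^-1
      * (\sum_(y : A | e (val x) (val y)) a (val x) (val y) * f y)
  + q (val x) * f x.

Definition zero_ext (R : realType) (V : choiceType) (A : {fset V})
    (f : A -> R) (x : V) : R :=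
  if insub x is Some y then f y else 0.

(* [dirichlet] is the compression of [jacobi] to functions supported in [A]. *)
Lemma dirichletE (R : realType) (V : choiceType) (e : rel V)
    (a : V -> V -> R) (q : V -> R) (A : {fset V}) (f : A -> R) (x : A) :
  finite_set (nbhd_set e (val x)) -> (0 < deg e (val x))%N ->
  dirichlet e a q f x = jacobi e a q (zero_ext f) (val x).
Proof.
move=> fin_x deg_x.
have extE (y : A) : zero_ext f (val y) = f y by rewrite /zero_ext valK.
rewrite /dirichlet /jacobi extE; congr (_ + _).
rewrite sumrB mulrBr; congr (_ - _ * _).
  rewrite big_const_seq count_predT iter_addr_0 -/(deg e (val x)).
  by rewrite -[f x *+ _]mulr_natl mulKf // pnatr_eq0 -lt0n.
rewrite [RHS](bigID (mem A)) /= [X in _ + X]big1 ?addr0; last first.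
  by move=> y yA; rewrite /zero_ext insubN ?mulr0.
rewrite (eq_bigr (fun y : A => a (val x) (val y) * zero_ext f (val y)));
  last by move=> y _; rewrite extE.
rewrite -(big_seq_fsetE _ _ (e (val x)) (fun y => a (val x) y * zero_ext f y)).
rewrite -[LHS]big_filter -[RHS]big_filter; apply: perm_big.
apply: uniq_perm; rewrite ?filter_uniq ?fset_uniq // => y.
rewrite !mem_filter in_fset_set // andbC; congr (_ && _).
by apply/idP/idP; rewrite inE.
Qed.

(* The matrix element <x|L|y>. *)
Definition mxel (R : realType) (T : choiceType)
    (L : (T -> R) -> (T -> R)) (x y : T) : R :=
  L (\1_[set y] : T -> R) x.

(* The exponential series [\sum_k L^k / k!], applied to [f] and summed pointwise;
   it converges for every linear [L] on a finite [T]. *)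
Definition exp_op (R : realType) (T : Type)
    (L : (T -> R) -> (T -> R)) (f : T -> R) (x : T) : R :=
  limn (series (fun k : nat => iter k L f x / k`!%:R)).

Definition op_eigenvalue (R : realType) (T : Type)
    (L : (T -> R) -> (T -> R)) (l : R) : Prop :=
  exists f : T -> R, (exists x, f x != 0) /\ forall x, L f x = l * f x.

(* This definition and [landscape] describe an object by its defining property;
   the default values of [xget] are never reached for [dirichlet] on a finite
   nonempty set in an infinite connected locally finite graph, where that
   operator is self-adjoint for the weight [deg] and strictly positive. *)
Definition smallest_eigenvalue (R : realType) (T : Type)
    (L : (T -> R) -> (T -> R)) : R :=
  xget 0 [set l | op_eigenvalue L l /\ forall m, op_eigenvalue L m -> l <= m].

Definition landscape (R : realType) (V : choiceType) (e : rel V)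
    (a : V -> V -> R) (q : V -> R) (A : {fset V}) : A -> R :=
  xget (fun=> 0) [set u : A -> R | forall x, dirichlet e a q u x = 1].

Definition sup_norm (R : realType) (T : finType) (f : T -> R) : R :=
  \big[Num.max/0]_(x : T) `|f x|.

Definition volume_growth (R : realType) (V : choiceType) (e : rel V)
    (CU z : R) : Prop :=
  forall (x : V) (r : nat), (1 <= r)%N ->
    (counting [set y : V | (gdist e x y <= r)%N] <= (CU * r%:R `^ z)%:E)%E.

(* In a connected graph [x != y] means that the distance is at least 1. *)
Definition heat_kernel_bound (R : realType) (V : choiceType) (e : rel V)
    (a : V -> V -> R) (q : V -> R) (z c1 c2 c3 c4 c5 : R) : Prop :=
  forall (A : {fset V}) (t : R) (x y : A), 0 < t ->
    let d : R := (gdist e (val x) (val y))%:R in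
    mxel (exp_op (fun f w => - t * dirichlet e a q f w)) x y <=
      if x == y then c5 * t `^ (- (z / 2))
      else if d <= t then c1 * t `^ (- (z / 2)) * expR (- (c2 * d ^+ 2 / t))
      else c3 * expR (- (c4 * d)).

(* Main.v *)
Require Import Defs.
From HB Require Import structures.
From mathcomp Require Import all_boot all_order all_algebra.
From mathcomp Require Import finmap complex ring lra.
From mathcomp Require Import all_classical all_reals all_analysis.
Set Implicit Arguments.
Unset Strict Implicit.
Unset Printing Implicit Defensive.
Import Order.TTheory GRing.Theory Num.Theory.
Import numFieldNormedType.Exports.
Local Open Scope classical_set_scope.
Local Open Scope ring_scope.

(** The heat semigroup is expanded in a tight frame of real eigenfunctions, namely
    the real and imaginary parts of a unitary eigenbasis over [R[i]]. The lower
    bound follows from the maximum principle applied to [lam |phi| u +- phi] for a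
    ground state [phi]. For the upper bound, [exp (- T H) u >= u - T] for all
    [T >= 0], so it suffices to find a time [T] of order [1 / lam] at which the row
    sums of the heat kernel are at most [1/2]: then [|u| <= T + |u| / 2]. Take [T]
    proportional to [r^2] and sum over shells of width [r]. On the ball of radius
    [r] the on-diagonal bound gains a factor [exp (- lam T / 2)], which beats the
    volume; on the other shells the assumed off-diagonal tails do. If [lam >= 2],
    then [q >= lam - 1 >= lam / 2] on [A] and comparison with constants suffices. *)

(** * Real eigenframes of symmetrizable kernels *)

(** A unitary diagonalization of [S] over [R[i]] has real eigenvalues, so the real and imaginary
    parts of each row of [P] are eigenvectors too. The real part of [PP] is the frame identity. *)
Lemma symmetric_eigenframe (R : realType) (n : nat) (S : 'M[R]_n) :
  S^T = S ->
  exists (phi : bool * 'I_n -> 'I_n -> R) (l : bool * 'I_n -> R),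
    (forall j i, \sum_k S i k * phi j k = l j * phi j i) /\
    (forall i k, \sum_j phi j i * phi j k = (i == k)%:R).
Proof.
move=> symS; pose C := R[i].
pose Sc : 'M[C]_n := map_mx (real_complex R) S.
have hermS : Sc \is hermsymmx.
  apply/is_hermitianmxP; rewrite expr0 scale1r; apply/matrixP => i j.
  rewrite !mxE -[in LHS]symS mxE; apply/esym/CrealP.
  by rewrite complex_real.
have /hermitian_normalmx /orthomx_spectralP := hermS.
set P := spectralmx Sc; set d := spectral_diag Sc => SE.
have unitP : P \is unitarymx by exact: spectral_unitarymx.
have reald j : complex.Im (d 0 j) = 0.
  have /mxOverP/(_ 0 j) := hermitian_spectral_diag_real hermS.
  by move=> /complex_realP[k]; rewrite -/d => ->.
have PS : P *m Sc = diag_mx d *m P.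
  by rewrite SE -mulmxA mulKVmx// spectral_unit.
have PP : map_mx Num.conj_op P^T *m P = 1%:M.
  by rewrite -invmx_unitary// mulVmx// spectral_unit.
have Re_sum (F : 'I_n -> C) :
    complex.Re (\sum_i F i) = \sum_i complex.Re (F i).
  by apply: (big_morph (@complex.Re R)) => // -[? ?] [? ?].
have Im_sum (F : 'I_n -> C) :
    complex.Im (\sum_i F i) = \sum_i complex.Im (F i).
  by apply: (big_morph (@complex.Im R)) => // -[? ?] [? ?].
exists (fun j i => if j.1 then complex.Re (P j.2 i) else complex.Im (P j.2 i)).
exists (fun j => complex.Re (d 0 j.2)); split.
  move=> [b j] i /=; have /matrixP/(_ j i) := PS.
  rewrite mul_diag_mx [LHS]mxE [RHS]mxE.
  have SkE k : P j k * Sc k i = complex.Complex (S i k * complex.Re (P j k))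
                                  (S i k * complex.Im (P j k)).
    rewrite mxE -[in LHS]symS mxE; case: (P j k) => x y /=.
    by apply/eqP; rewrite eq_complex /= !mulr0 subr0 add0r !(mulrC (S i k)) !eqxx.
  rewrite (eq_bigr _ (fun k _ => SkE k)).
  have dE : d 0 j * P j i = complex.Complex (complex.Re (d 0 j) * complex.Re (P j i))
                                  (complex.Re (d 0 j) * complex.Im (P j i)).
    have := reald j; case: (d 0 j) => x ? /= ->; case: (P j i) => u v /=.
    by apply/eqP; rewrite eq_complex /= !mul0r subr0 addr0 !eqxx.
  rewrite dE; case: b => E.
    by have := congr1 (@complex.Re R) E; rewrite Re_sum.
  by have := congr1 (@complex.Im R) E; rewrite Im_sum.
move=> i k; have /matrixP/(_ i k) := PP; rewrite !mxE.
move=> /(congr1 (@complex.Re R)); rewrite Re_sum.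
have -> : complex.Re ((i == k)%:R : C) = (i == k)%:R by case: (i == k).
move=> <-; rewrite -(pair_bigA _ (fun b j =>
  (if b then complex.Re (P j i) else complex.Im (P j i)) *
  (if b then complex.Re (P j k) else complex.Im (P j k)))) /=.
rewrite big_bool /= -big_split /=; apply: eq_bigr => j _.
rewrite !mxE; case: (P j i) => x y; case: (P j k) => u v /=.
by rewrite mulNr opprK.
Qed.

(** Conjugation by the square root of [m] makes [h] symmetric; the frame is carried back by dividing
    by that root. *)
Lemma weighted_eigenframe (R : realType) (T : finType) (m : T -> R)
    (h : T -> T -> R) :
  (forall x, 0 < m x) -> (forall x y, m x * h x y = m y * h y x) ->
  exists (J : finType) (psi : J -> T -> R) (l : J -> R),
    (forall j x, \sum_y h x y * psi j y = l j * psi j x) /\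
    (forall x y, \sum_j psi j x * psi j y * m y = (x == y)%:R).
Proof.
move=> m_gt0 symh; pose s x := Num.sqrt (m x).
have s_gt0 x : 0 < s x by rewrite sqrtr_gt0.
have s_neq0 x : s x != 0 by rewrite gt_eqF.
have sE x : m x = s x * s x by rewrite -expr2 sqr_sqrtr// ltW.
pose S : 'M[R]_#|T| := \matrix_(i, k)
  (s (enum_val i) * h (enum_val i) (enum_val k) / s (enum_val k)).
have symS : S^T = S.
  apply/matrixP => i k; rewrite !mxE; set x := enum_val i; set y := enum_val k.
  apply/eqP; rewrite eqr_div ?s_neq0//; apply/eqP.
  by have := symh x y; rewrite !sE => E; rewrite mulrAC -E mulrAC.
have [phi [l [phiE phiI]]] := symmetric_eigenframe symS.
exists (bool * 'I_#|T|)%type, (fun j x => phi j (enum_rank x) / s x), l; split.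
  move=> j x; have := phiE j (enum_rank x).
  rewrite (reindex (@enum_rank T)) /=; last first.
    by apply: onW_bij; exact: enum_rank_bij.
  move=> /(congr1 (fun r => r / s x)); rewrite mulrA => <-.
  rewrite mulr_suml; apply: eq_bigr => y _; rewrite mxE !enum_rankK.
  have := s_neq0 x; have := s_neq0 y.
  by move=> *; field; apply/andP.
move=> x y; have := phiI (enum_rank x) (enum_rank y).
rewrite (inj_eq enum_rank_inj) => E.
have -> : \sum_j phi j (enum_rank x) / s x * (phi j (enum_rank y) / s y) * m y
   = (\sum_j phi j (enum_rank x) * phi j (enum_rank y)) * (s y / s x).
  rewrite mulr_suml; apply: eq_bigr => j _; rewrite sE.
  by field; rewrite ?s_neq0.
rewrite E; case: eqVneq => [->|_]; last by rewrite mul0r.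
by rewrite divff// mulr1.
Qed.

(** * Heat semigroups of finite kernels *)

Definition kernel_op (R : realType) (T : finType) (h : T -> T -> R)
    (f : T -> R) (x : T) : R := \sum_y h x y * f y.

(* A tight frame of [ell^2(T, m)] made of eigenfunctions; members may vanish. *)
Definition eigenframe (R : realType) (T J : finType) (m : T -> R)
    (h : T -> T -> R) (psi : J -> T -> R) (l : J -> R) : Prop :=
  (forall j x, kernel_op h (psi j) x = l j * psi j x) /\
  (forall x y, \sum_j psi j x * psi j y * m y = (x == y)%:R).

Definition frame_coef (R : realType) (T J : finType) (m : T -> R)
    (psi : J -> T -> R) (f : T -> R) (j : J) : R := \sum_y f y * psi j y * m y.

Lemma sum_delta_mul (R : realType) (T : finType) (f : T -> R) (x : T) :
  \sum_y (x == y)%:R * f y = f x.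
Proof.
rewrite (bigD1 x)//= eqxx mul1r big1 ?addr0// => y /negbTE yx.
by rewrite eq_sym yx mul0r.
Qed.

Lemma kernel_op_le (R : realType) (T : finType) (h : T -> T -> R)
    (f g : T -> R) (x : T) :
  (forall y, 0 <= h x y) -> (forall y, f y <= g y) ->
  kernel_op h f x <= kernel_op h g x.
Proof. by move=> h0 fg; apply: ler_sum => y _; exact: ler_wpM2l. Qed.

Lemma kernel_op_sum (R : realType) (T J : finType) (h : T -> T -> R)
    (c : J -> R) (F : J -> T -> R) (x : T) :
  kernel_op h (fun y => \sum_j c j * F j y) x
  = \sum_j c j * kernel_op h (F j) x.
Proof.
rewrite /kernel_op; under eq_bigr do rewrite mulr_sumr.
rewrite exchange_big; apply: eq_bigr => j _; rewrite mulr_sumr.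
by apply: eq_bigr => y _; rewrite mulrCA.
Qed.

Lemma eigenframe_affine (R : realType) (T J : finType) (m : T -> R)
    (h : T -> T -> R) (psi : J -> T -> R) (l : J -> R) (c t : R) :
  eigenframe m h psi l ->
  eigenframe m (fun x y => c * (x == y)%:R + t * h x y) psi
    (fun j => c + t * l j).
Proof.
move=> [hpsi ?]; split=> // j x; have := hpsi j x; rewrite /kernel_op => E.
under eq_bigr do rewrite mulrDl -!mulrA.
by rewrite big_split/= -!mulr_sumr sum_delta_mul E mulrDl !mulrA.
Qed.

Lemma eigenframe_scale (R : realType) (T J : finType) (m : T -> R)
    (h : T -> T -> R) (psi : J -> T -> R) (l : J -> R) (t : R) :
  eigenframe m h psi l ->
  eigenframe m (fun x y => t * h x y) psi (fun j => t * l j).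
Proof.
move=> [hpsi ?]; split=> // j x; rewrite -mulrA -hpsi /kernel_op mulr_sumr.
by apply: eq_bigr => y _; rewrite mulrA.
Qed.

Lemma frame_expand (R : realType) (T J : finType) (m : T -> R)
    (h : T -> T -> R) (psi : J -> T -> R) (l : J -> R) (f : T -> R) (x : T) :
  eigenframe m h psi l -> f x = \sum_j frame_coef m psi f j * psi j x.
Proof.
move=> [_ framepsi]; rewrite -[LHS](sum_delta_mul f x).
under eq_bigr do rewrite -framepsi mulr_suml.
rewrite exchange_big; apply: eq_bigr => j _; rewrite /frame_coef mulr_suml.
by apply: eq_bigr => y _; ring.
Qed.

(** Although frame members may be linearly dependent, powers act term by term on the reconstruction
    of [f]. *)
Lemma iter_kernel_op (R : realType) (T J : finType) (m : T -> R)
    (h : T -> T -> R) (psi : J -> T -> R) (l : J -> R) (f : T -> R) k (x : T) :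
  eigenframe m h psi l ->
  iter k (kernel_op h) f x = \sum_j l j ^+ k * (frame_coef m psi f j * psi j x).
Proof.
move=> fr; elim: k x => [x|k IH x].
  by rewrite /= (frame_expand f x fr); apply: eq_bigr => j _; rewrite mul1r.
rewrite iterS (_ : iter k _ f = fun y =>
    \sum_j (l j ^+ k * frame_coef m psi f j) * psi j y); last first.
  by apply/funext => y; rewrite IH; apply: eq_bigr => j _; rewrite mulrA.
by rewrite kernel_op_sum; apply: eq_bigr => j _; rewrite fr.1 exprSr; ring.
Qed.

Lemma cvg_sum_exp_series (R : realType) (J : finType) (l d : J -> R) :
  series (fun k => (\sum_j l j ^+ k * d j) / k`!%:R) n @[n --> \oo] -->
  \sum_j expR (l j) * d j.
Proof.
have -> : series (fun k => (\sum_j l j ^+ k * d j) / k`!%:R) =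
          fun n => \sum_j series (exp_coeff (l j)) n * d j.
  apply/funext => n; rewrite /series /=.
  under eq_bigr do rewrite mulr_suml.
  rewrite exchange_big; apply: eq_bigr => j _; rewrite mulr_suml.
  by apply: eq_bigr => k _; rewrite /exp_coeff /= mulrAC.
apply: cvg_big => [|j _]; first exact: add_continuous.
by apply: cvgMr_tmp; exact: is_cvg_series_exp_coeff.
Qed.

Lemma exp_op_kernel (R : realType) (T J : finType) (m : T -> R)
    (h : T -> T -> R) (psi : J -> T -> R) (l : J -> R) (f : T -> R) (x : T) :
  eigenframe m h psi l ->
  exp_op (kernel_op h) f x
  = \sum_j expR (l j) * (frame_coef m psi f j * psi j x).
Proof.
move=> fr; rewrite /exp_op.
under eq_fun do rewrite (iter_kernel_op _ _ _ fr).
by apply: cvg_lim => //; exact: cvg_sum_exp_series.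
Qed.

Lemma mxel_exp_op (R : realType) (T J : finType) (m : T -> R)
    (h : T -> T -> R) (psi : J -> T -> R) (l : J -> R) (x y : T) :
  eigenframe m h psi l ->
  mxel (exp_op (kernel_op h)) x y
  = \sum_j expR (l j) * (psi j x * psi j y * m y).
Proof.
move=> fr; rewrite /mxel (exp_op_kernel _ _ fr); apply: eq_bigr => j _.
congr (_ * _); rewrite /frame_coef (bigD1 y)//= big1 => [|w wy].
  by rewrite indicE in_set1 eqxx mul1r addr0 mulrC mulrA.
by rewrite indicE in_set1 (negbTE wy) !mul0r.
Qed.

Lemma exp_op_mxel (R : realType) (T J : finType) (m : T -> R)
    (h : T -> T -> R) (psi : J -> T -> R) (l : J -> R) (f : T -> R) (x : T) :
  eigenframe m h psi l ->
  exp_op (kernel_op h) f x = \sum_y mxel (exp_op (kernel_op h)) x y * f y.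
Proof.
move=> fr; rewrite (exp_op_kernel _ _ fr).
under [RHS]eq_bigr do rewrite (mxel_exp_op _ _ fr) mulr_suml.
rewrite exchange_big; apply: eq_bigr => j _.
rewrite /frame_coef mulr_suml mulr_sumr; apply: eq_bigr => y _; ring.
Qed.

(* AM-GM on [psi j x * psi j y] costs only the ratio of the weights. *)
Lemma heat_kernel_spectral_decay (R : realType) (T J : finType) (m : T -> R)
    (h : T -> T -> R) (psi : J -> T -> R) (l : J -> R) (lam M t b : R)
    (x y : T) :
  eigenframe m h psi l ->
  (forall j, (exists w, psi j w != 0) -> lam <= l j) ->
  0 <= t -> (forall w, 1 <= m w <= M) ->
  (forall w, mxel (exp_op (kernel_op (fun x y => - (t / 2) * h x y))) w w <= b) ->
  mxel (exp_op (kernel_op (fun x y => - t * h x y))) x y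
    <= expR (- (lam * t / 2)) * (M * b).
Proof.
move=> fr lamP t0 mM hb.
have frt (s : R) := eigenframe_scale (- s) fr.
rewrite (mxel_exp_op _ _ (frt t)).
pose D w := \sum_j expR (- (t / 2) * l j) * (psi j w * psi j w * m w).
have Db w : D w <= b by have := hb w; rewrite (mxel_exp_op _ _ (frt _)).
have m0 w : 0 <= m w by have /andP[+ _] := mM w; apply: le_trans.
have M0 : 0 <= M by have /andP[_] := mM x; apply: le_trans.
apply: (@le_trans _ _ (expR (- (lam * t / 2)) * (M / 2 * (D x + D y)))); last first.
  rewrite ler_pM2l ?expR_gt0//.
  have := Db x; have := Db y => *.
  have -> : M * b = M / 2 * (b + b) by field.
  by apply: ler_wpM2l; [rewrite divr_ge0|exact: lerD].
rewrite -big_split/= 2!mulr_sumr; apply: ler_sum => j _.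
(* A vanishing member satisfies its eigenvalue equation for any [l j], so [lamP] speaks of
   nonvanishing ones only. *)
have [[w pw]|/forallNP psi0] := pselect (exists w, psi j w != 0); last first.
  have z w : psi j w = 0 by apply/eqP/negPn/negP/psi0.
  by rewrite !z !(mul0r, mulr0, addr0).
have lamj := lamP j (ex_intro _ w pw).
(* One half of the time yields the decay factor, the other rebuilds the diagonal kernel at time
   [t / 2]. *)
have -> : - t * l j = - (t / 2) * l j + - (t / 2) * l j by field.
rewrite expRD.
have e1 : expR (- (t / 2) * l j) <= expR (- (lam * t / 2)).
  rewrite ler_expR mulNr lerN2 -mulrA mulrC.
  by apply: ler_wpM2l => //; rewrite divr_ge0.
set p := psi j x; set q := psi j y; set E := expR (- (t / 2) * l j).
have sq0 : 0 <= p ^+ 2 + q ^+ 2 by rewrite addr_ge0// sqr_ge0.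
have /andP[mx _] := mM x; have /andP[my1 my] := mM y.
(* AM-GM leaves the single weight [m y]; it is raised to [M], after which [m x] and [m y], both at
   least 1, are inserted. *)
have pq : p * q * m y <= M / 2 * (p * p * m x + q * q * m y).
  apply: (@le_trans _ _ ((p ^+ 2 + q ^+ 2) / 2 * m y)).
    by apply: ler_wpM2r => //; have := sqr_ge0 (p - q); lra.
  apply: (@le_trans _ _ ((p ^+ 2 + q ^+ 2) / 2 * M)).
    by apply: ler_wpM2l => //; rewrite divr_ge0.
  rewrite mulrAC -mulrA mulrC; apply: ler_wpM2l; first by rewrite divr_ge0.
  rewrite -!expr2; apply: lerD.
    by rewrite ler_peMr ?sqr_ge0.
  by rewrite ler_peMr ?sqr_ge0.
have q0 : 0 <= M / 2 * (p * p * m x + q * q * m y).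
  by rewrite mulr_ge0 ?divr_ge0// addr_ge0// mulr_ge0// -expr2 sqr_ge0.
rewrite [leRHS](_ : _ = expR (- (lam * t / 2)) * E *
    (M / 2 * (p * p * m x + q * q * m y))); last by ring.
apply: (@le_trans _ _ (E * E * (M / 2 * (p * p * m x + q * q * m y)))).
  by apply: ler_wpM2l => //; rewrite mulr_ge0 ?expR_ge0.
by apply: ler_wpM2r => //; apply: ler_wpM2r => //; exact: expR_ge0.
Qed.

(** By self-adjointness the coefficients of an eigenfunction for [r] satisfy [r c_j = l_j c_j], so
    every eigenvalue is some [l j] with [psi j] nonzero. Their minimum is therefore what [xget]
    selects. *)
Lemma smallest_eigenvalueP (R : realType) (T J : finType) (m : T -> R)
    (h : T -> T -> R) (psi : J -> T -> R) (l : J -> R) (x0 : T) :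
  (forall x y, m x * h x y = m y * h y x) -> eigenframe m h psi l ->
  op_eigenvalue (kernel_op h) (smallest_eigenvalue (kernel_op h)) /\
  (forall j, (exists w, psi j w != 0) ->
     smallest_eigenvalue (kernel_op h) <= l j).
Proof.
move=> symh fr; pose nz j := [exists w, psi j w != 0].
have nzE j : (exists w, psi j w != 0) -> nz j by move=> [w ?]; apply/existsP; exists w.
have eigl j : nz j -> op_eigenvalue (kernel_op h) (l j).
  by move=> /existsP[w pw]; exists (psi j); split; [exists w|exact: fr.1].
(* If all members vanished, the frame identity at [(x0, x0)] would read 0 = 1. *)
have [j0 nzj0] : exists j, nz j.
  apply/existsP; apply: contraT => /existsPn nnz.
  have := fr.2 x0 x0; rewrite eqxx big1 => [/esym/eqP|j _]; first by rewrite oner_eq0.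
  have /existsPn/(_ x0) := nnz j; rewrite negbK => /eqP ->.
  by rewrite !mul0r.
have [j1 nzj1 minj1] := arg_minP l nzj0.
have [] : [set r | op_eigenvalue (kernel_op h) r /\
    forall r', op_eigenvalue (kernel_op h) r' -> r <= r']
    (smallest_eigenvalue (kernel_op h)); last first.
  by move=> ? lamP; split=> // j /nzE/eigl; exact: lamP.
apply: (@xgetI _ _ _ (l j1)); split; first exact: eigl.
move=> r [f [[w fw] fE]].
have cE j : r * frame_coef m psi f j = l j * frame_coef m psi f j.
  rewrite /frame_coef !mulr_sumr.
  transitivity (\sum_y \sum_x m y * h y x * f x * psi j y).
    apply: eq_bigr => y _; rewrite mulrA mulrA -fE /kernel_op !mulr_suml.
    by apply: eq_bigr => x _; ring.
  rewrite exchange_big; apply: eq_bigr => x _.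
  transitivity (f x * m x * kernel_op h (psi j) x); last by rewrite fr.1; ring.
  rewrite /kernel_op mulr_sumr; apply: eq_bigr => y _; rewrite symh; ring.
have [j /andP[cj pj]] : exists j, (frame_coef m psi f j != 0) && (psi j w != 0).
  apply/existsP; apply: contraT => /existsPn H.
  move: fw; rewrite (frame_expand f w fr) big1 ?eqxx// => j _.
  by have := H j; rewrite negb_and !negbK => /orP[]/eqP ->; rewrite ?mul0r ?mulr0.
have -> : r = l j by apply: (mulIf cj); exact: cE.
by apply: minj1; apply/existsP; exists w.
Qed.

(** The entry [h x x] is the Rayleigh quotient of the indicator of [x], hence an average of the
    [l j] with weights [psi j x ^+ 2 * m x] of total 1. *)
Lemma smallest_eigenvalue_le_diag (R : realType) (T J : finType) (m : T -> R)
    (h : T -> T -> R) (psi : J -> T -> R) (l : J -> R) (lam : R) (x : T) :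
  0 <= m x -> eigenframe m h psi l ->
  (forall j, (exists w, psi j w != 0) -> lam <= l j) -> lam <= h x x.
Proof.
move=> mx fr lamP.
have -> : h x x = \sum_j l j * (psi j x * psi j x * m x).
  transitivity (\sum_y h x y * (x == y)%:R).
    by rewrite -(sum_delta_mul (h x) x); apply: eq_bigr => y _; rewrite mulrC.
  under eq_bigr do rewrite eq_sym -fr.2 mulr_sumr.
  rewrite exchange_big; apply: eq_bigr => j _.
  transitivity (kernel_op h (psi j) x * (psi j x * m x)).
    by rewrite /kernel_op mulr_suml; apply: eq_bigr => y _; rewrite !mulrA.
  by rewrite fr.1 !mulrA.
have -> : lam = \sum_j lam * (psi j x * psi j x * m x).
  by rewrite -mulr_sumr fr.2 eqxx mulr1.
apply: ler_sum => j _; have [->|p0] := eqVneq (psi j x) 0.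
  by rewrite !(mul0r, mulr0).
apply: ler_wpM2r; last by apply: lamP; exists x.
by rewrite mulr_ge0// -expr2 sqr_ge0.
Qed.

Lemma series_exp_coeff_le (R : realType) (x : R) n :
  0 <= x -> series (exp_coeff x) n <= expR x.
Proof.
move=> x0; apply: nondecreasing_cvgn_le; last exact: is_cvg_series_exp_coeff.
by apply: nondecreasing_series => k _ _; exact: exp_coeff_ge0.
Qed.

(** This is a partial sum, with nonnegative terms, of the derivative in [c] of [exp (t c)]. It sums
    the corrections [k c^(k-1)] of the uniformization argument. *)
Lemma sum_deriv_exp_coeff_le (R : realType) (c t : R) n :
  0 <= c -> 0 <= t ->
  \sum_(0 <= k < n) k%:R * c ^+ k.-1 * t ^+ k / k`!%:R <= t * expR (t * c).
Proof.
move=> c0 t0; case: n => [|n].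
  by rewrite big_geq// mulr_ge0// expR_ge0.
rewrite big_nat_recl//= !mul0r add0r.
apply: (@le_trans _ _ (t * series (exp_coeff (t * c)) n)); last first.
  by apply: ler_wpM2l => //; apply: series_exp_coeff_le; rewrite mulr_ge0.
rewrite /series /= mulr_sumr; apply: ler_sum => k _.
rewrite /exp_coeff /= factS natrM exprMn exprS le_eqVlt; apply/orP; left.
have : k`!%:R != 0 :> R by rewrite pnatr_eq0 -lt0n fact_gt0.
by move=> f0; apply/eqP; field; rewrite f0 -(natrD _ 1) add1n pnatr_eq0.
Qed.

(* Uniformization: [B = c - H] has nonnegative entries and [B 1 <= c], so
   [B u = c u - 1] gives [B^k u >= c^k u - k c^(k-1)]; these inequalities are
   summed in [exp (- t H) = exp (- t c) \sum_k t^k B^k / k!]. *)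
Lemma heat_flow_lower_bound (R : realType) (T J : finType) (m : T -> R)
    (h : T -> T -> R) (psi : J -> T -> R) (l : J -> R) (u : T -> R) (t : R)
    (x : T) :
  eigenframe m h psi l ->
  (forall x y, x != y -> h x y <= 0) -> (forall x, 0 <= \sum_y h x y) ->
  (forall x, kernel_op h u x = 1) -> 0 <= t ->
  u x - t <= exp_op (kernel_op (fun x y => - t * h x y)) u x.
Proof.
move=> fr offdiag rowsum uE t0.
pose c := \sum_x `|h x x|.
have c0 : 0 <= c by apply: sumr_ge0.
have hc y : h y y <= c.
  by rewrite /c (bigD1 y)//= ler_wpDr ?ler_norm// sumr_ge0.
pose b x y := c * (x == y)%:R + -1 * h x y.
have frb : eigenframe m b psi (fun j => c + -1 * l j) by exact: eigenframe_affine.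
have bE f y : kernel_op b f y = c * f y - kernel_op h f y.
  rewrite /kernel_op; under eq_bigr do rewrite mulrDl -!mulrA mulN1r.
  by rewrite big_split/= -mulr_sumr sum_delta_mul sumrN.
have b0 y z : 0 <= b y z.
  rewrite /b mulN1r subr_ge0; have [->|yz] := eqVneq; first by rewrite mulr1.
  by rewrite mulr0; exact: offdiag.
(* At [k = 0] the factor [k%:R] kills the meaningless power [c ^+ k.-1]. The induction step drops
   [k c^(k-1)] times a row sum of [h], which is nonnegative. *)
have iterB k y : c ^+ k * u y - k%:R * c ^+ k.-1 <= iter k (kernel_op b) u y.
  elim: k y => [y|k IH y]; first by rewrite expr0 mul1r mul0r subr0.
  rewrite iterS.
  apply: (le_trans _ (kernel_op_le (b0 y) IH)).
  have kc : k%:R * c ^+ k.-1 * c = k%:R * c ^+ k.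
    by case: k {IH} => [|k]; rewrite ?mul0r// -mulrA -exprSr.
  rewrite bE; have -> : kernel_op h (fun y => c ^+ k * u y - k%:R * c ^+ k.-1) y =
     c ^+ k - k%:R * c ^+ k.-1 * \sum_z h y z.
    rewrite -[X in X - _]mulr1 -(uE y) /kernel_op !mulr_sumr -sumrB.
    by apply: eq_bigr => z _; ring.
  have := mulr_ge0 (mulr_ge0 (ler0n R k) (exprn_ge0 k.-1 c0)) (rowsum y).
  rewrite [(k.+1).-1]/= mulrBr [c * (_ * c ^+ k.-1)]mulrC kc.
  by rewrite exprS -natr1 mulrDl mul1r mulrA; lra.
rewrite (exp_op_kernel _ _ (eigenframe_scale (- t) fr)).
pose d j := frame_coef m psi u j * psi j x.
(* The claim multiplied by [exp (t c)] is proved for partial sums and passes to the limit. *)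
have : expR (t * c) * u x - t * expR (t * c) <=
    \sum_j expR (t * (c + -1 * l j)) * d j.
  have C1 : series (exp_coeff (t * c)) n * u x - t * expR (t * c) @[n --> \oo] -->
      expR (t * c) * u x - t * expR (t * c).
    apply: cvgB; last exact: cvg_cst.
    by apply: cvgMr_tmp; exact: is_cvg_series_exp_coeff.
  apply: (ler_cvg_to C1 (@cvg_sum_exp_series _ _ (fun j => t * (c + -1 * l j)) d)).
  apply: nearW => n /=.
  apply: (le_trans (lerB (lexx _) (sum_deriv_exp_coeff_le n c0 t0))).
  rewrite /series /= mulr_suml -sumrB; apply: ler_sum => k _.
  rewrite /exp_coeff /= mulrAC -mulrBl ler_wpM2r//.
  have -> : \sum_j (t * (c + -1 * l j)) ^+ k * d j = t ^+ k * iter k (kernel_op b) u x.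
    rewrite (iter_kernel_op _ _ _ frb) mulr_sumr.
    by apply: eq_bigr => j _; rewrite exprMn mulrA.
  have := ler_wpM2l (exprn_ge0 k t0) (iterB k x).
  by rewrite exprMn mulrBr; lra.
have -> : \sum_j expR (t * (c + -1 * l j)) * d j =
    expR (t * c) * \sum_j expR (- t * l j) * d j.
  rewrite mulr_sumr; apply: eq_bigr => j _; rewrite mulrA -expRD.
  by congr (expR _ * _); ring.
by rewrite [t * expR _]mulrC -mulrBr ler_pM2l ?expR_gt0.
Qed.

(** * Summation over shells *)

Lemma sum_inv_sqr_le2 (R : realType) n :
  \sum_(k < n) ((k.+1)%:R ^-1) ^+ 2 <= 2 :> R.
Proof.
case: n => [|n]; first by rewrite big_ord0.
(* The sharper bound is inductive, since [1/(n+1)^2 <= 1/n - 1/(n+1)]. *)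
suff: \sum_(k < n.+1) ((k.+1)%:R ^-1) ^+ 2 <= 2 - (n.+1)%:R^-1 :> R.
  by move=> /le_trans; apply; rewrite gerBl invr_ge0.
elim: n => [|n IH]; first by rewrite big_ord_recl big_ord0 invr1; lra.
rewrite big_ord_recr /=; apply: (le_trans (lerD IH (lexx _))).
rewrite -[(n.+2)%:R]natr1; set x := (n.+1)%:R.
have x0 : 0 < x by rewrite ltr0n.
have x10 : 0 < x + 1 by rewrite ltr_wpDr.
rewrite -addrA lerD2l -subr_ge0.
have -> : - (x + 1)^-1 - (- x^-1 + ((x + 1)^-1) ^+ 2) =
  x^-1 * ((x + 1)^-1) ^+ 2 by field; rewrite !gt_eqF.
by rewrite mulr_ge0// ?exprn_ge0// invr_ge0 ltW.
Qed.

(* Points are grouped in shells of width [r]; the [k]-th one lies in a ball of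
   radius [(k + 1) r]. *)
Lemma sum_shell_weight_le (R : realType) (T : finType) (d : T -> nat)
    (CU z : R) (N r : nat) :
  0 <= CU -> (0 < r)%N -> z + 2 <= N%:R ->
  (forall n, (0 < n)%N -> #|[pred y | (d y <= n)%N]|%:R <= CU * n%:R `^ z) ->
  \sum_y ((d y %/ r).+1%:R^-1) ^+ N <= 2 * CU * r%:R `^ z.
Proof.
move=> CU0 r0 zN ball; pose K := (\max_y d y).+1.
have dK y : (d y %/ r < K)%N.
  by rewrite ltnS (leq_trans (leq_div _ _))// leq_bigmax.
rewrite (partition_big (fun y => Ordinal (dK y)) predT)//=.
(* As [z + 2 <= N], the weight [(k+1)^(-N)] times the volume factor [(k+1)^z] still decays like
   [(k+1)^(-2)]. *)
apply: (@le_trans _ _ (\sum_(k < K) CU * r%:R `^ z * ((k.+1)%:R ^-1) ^+ 2)); last first.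
  rewrite -mulr_sumr -[leRHS]mulrA [leRHS]mulrC ler_wpM2l//.
    by rewrite mulr_ge0// powR_ge0.
  exact: sum_inv_sqr_le2.
apply: ler_sum => k _.
have k1 : 1 <= (k.+1)%:R :> R by rewrite ler1n.
have k0 : 0 < (k.+1)%:R :> R by rewrite ltr0n.
rewrite (eq_bigr (fun=> ((k.+1)%:R^-1) ^+ N)); last first.
  by move=> y /eqP <-.
rewrite sumr_const -[leLHS]mulr_natl.
apply: (@le_trans _ _ (CU * (k.+1 * r)%N%:R `^ z * ((k.+1)%:R^-1) ^+ N)).
  apply: ler_wpM2r; first by rewrite exprn_ge0// invr_ge0.
  apply: le_trans (ball _ _); last by rewrite muln_gt0.
  rewrite ler_nat; apply: subset_leq_card; apply/fintype.subsetP => y.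
  by rewrite !inE => /eqP <- /=; apply/ltnW/ltn_ceil.
rewrite natrM powRM//.
rewrite [leLHS](_ : _ = CU * r%:R `^ z * ((k.+1)%:R `^ z * ((k.+1)%:R^-1) ^+ N));
  last by ring.
apply: ler_wpM2l; first exact: mulr_ge0 CU0 (powR_ge0 _ _).
rewrite !exprVn ler_pdivrMr ?exprn_gt0// mulrC ler_pdivlMr ?exprn_gt0//.
rewrite -!powR_mulrn ?ler0n// -powRD ?pnatr_eq0 ?implybT//.
exact: ler_powR.
Qed.

(** From [1 + s <= exp s] at [s = c x / (N+1)] comes [x^(N+1) <= B exp (c x)]; the spare power of
    [x] gives an explicit threshold. *)
Lemma expr_expRN_small (R : realType) (N : nat) (a c delta : R) :
  0 <= a -> 0 < c -> 0 < delta ->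
  exists2 X : R, 1 <= X & forall x, X <= x -> a * x ^+ N * expR (- (c * x)) <= delta.
Proof.
move=> a0 c0 d0; pose B := ((N.+1)%:R / c) ^+ N.+1.
have B0 : 0 <= B by rewrite exprn_ge0// divr_ge0// ltW.
exists (Num.max 1 (a * B / delta)); first by rewrite le_max lexx.
move=> x; rewrite ge_max => /andP[x1 xX].
have x0 : 0 < x by apply: lt_le_trans x1.
have e1 : x ^+ N.+1 <= B * expR (c * x).
  set n := (N.+1)%:R : R; have n0 : 0 < n by rewrite ltr0n.
  have -> : c * x = n * (c * x / n) by field; rewrite gt_eqF.
  rewrite expRM_natl -exprMn; apply: lerXn2r.
  - by rewrite nnegrE ltW.
  - by rewrite nnegrE mulr_ge0 ?expR_ge0// divr_ge0// ltW.
  rewrite [leLHS](_ : _ = n / c * (c * x / n)); last by field; rewrite !gt_eqF.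
  rewrite ler_pM2l ?divr_gt0//; apply: le_trans (expR_ge1Dx _).
  by rewrite lerDr.
rewrite expRN ler_pdivrMr ?expR_gt0//.
rewrite -(ler_pM2r x0) -mulrA -exprSr.
apply: (le_trans (ler_wpM2l a0 e1)).
rewrite mulrA [delta * _ * _]mulrAC ler_wpM2r ?expR_ge0//.
by move: xX; rewrite ler_pdivrMr// [x * _]mulrC.
Qed.

(** Since [k + 1 <= 2 k] and [rho >= 1], both [(k+1)^N] and [rho^z] are absorbed in [(2 k rho)^N],
    so one threshold serves all shells. It is used for the Gaussian tail and, with [rho] replaced by
    [r], for the exponential one. *)
Lemma shell_profile_small (R : realType) (N : nat) (c z a delta : R) :
  0 <= a -> 0 < c -> 0 < delta -> z <= N%:R ->
  exists2 X : R, 1 <= X & forall rho (k : nat), X <= rho -> (0 < k)%N ->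
    a * rho `^ z * expR (- (c * (k%:R * rho))) <= delta * ((k.+1)%:R^-1) ^+ N.
Proof.
move=> a0 c0 d0 zN.
have [X X1 XP] := expr_expRN_small N (mulr_ge0 a0 (exprn_ge0 N (ler0n R 2))) c0 d0.
exists X => // rho k Xrho k0.
have rho1 : 1 <= rho by apply: le_trans Xrho.
have k1 : 1 <= k%:R :> R by rewrite ler1n.
have rho0 : 0 <= rho by apply: le_trans rho1.
have kp : 0 < (k.+1)%:R ^+ N :> R by rewrite exprn_gt0// ltr0n.
rewrite exprVn ler_pdivlMr//.
apply: le_trans (XP (k%:R * rho) _); last first.
  by apply: (le_trans Xrho); rewrite ler_peMl.
rewrite mulrAC ler_wpM2r ?expR_ge0// -!mulrA; apply: ler_wpM2l => //.
apply: (@le_trans _ _ (rho ^+ N * (2 * k%:R) ^+ N)).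
  apply: ler_pM; rewrite ?powR_ge0 ?exprn_ge0//.
    by rewrite -powR_mulrn//; exact: ler_powR.
  by apply: lerXn2r; rewrite ?nnegrE ?mulr_ge0// -natr1; lra.
by rewrite !exprMn le_eqVlt; apply/orP; left; apply/eqP; ring.
Qed.

(** * Dirichlet restrictions on an infinite graph *)

Lemma counting_leP (R : realType) (T : choiceType) (X : set T) (b : R) :
  (counting X <= b%:E)%E -> finite_set X /\ #|` fset_set X|%fset%:R <= b.
Proof.
rewrite /counting; case: ifPn => [fX|]; last by rewrite leye_eq.
by rewrite lee_fin; split=> //; exact/asboolP.
Qed.

Lemma sup_deg_le (R : realType) (V : choiceType) (e : rel V) (M : R) (x : V) :
  sup_deg R e = M%:E -> finite_set (nbhd_set e x) /\ (deg e x)%:R <= M.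
Proof.
move=> supM; apply: counting_leP; rewrite -supM.
by apply: ereal_sup_ubound; exists x.
Qed.

Lemma deg_gt0 (V : choiceType) (e : rel V) (x : V) :
  connected_graph e -> infinite_set [set: V] -> finite_set (nbhd_set e x) ->
  (0 < deg e x)%N.
Proof.
move=> conn infV finx.
have [y yx] : exists y, y != x.
  apply: contrapT => /forallNP H; apply: infV.
  rewrite (_ : [set: V] = [set x]); first exact: finite_set1.
  by apply/seteqP; split=> // y _; have /negP/negPn/eqP := H y.
have [_ [[|w p] [/= pth lst _]]] := conn x y.
  by rewrite lst eqxx in yx.
rewrite /deg cardfs_gt0; apply/fset0Pn; exists w.
by rewrite in_fset_set// inE; move: pth => /andP[].
Qed.

Lemma gdistxx (V : choiceType) (e : rel V) (x : V) : gdist e x x = 0%N.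
Proof.
have w0 : has_walk e x x 0 by exists [::].
have [|//] := @xgetPex _ 0%N [set n | has_walk e x x n /\
   forall m, has_walk e x x m -> (n <= m)%N].
  by exists 0%N.
by move=> _ /(_ 0%N w0); rewrite leqn0 => /eqP.
Qed.

Lemma le_sup_norm (R : realType) (T : finType) (f : T -> R) (x : T) :
  `|f x| <= sup_norm f.
Proof. exact: le_bigmax. Qed.

Lemma sup_norm_le (R : realType) (T : finType) (f : T -> R) (b : R) :
  0 <= b -> (forall x, `|f x| <= b) -> sup_norm f <= b.
Proof. by move=> b0 fb; apply: bigmax_le. Qed.

Lemma kernel_op_lin (R : realType) (T : finType) (h : T -> T -> R)
    (c d : R) (f g : T -> R) (x : T) :
  kernel_op h (fun y => c * f y + d * g y) x
  = c * kernel_op h f x + d * kernel_op h g x.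
Proof.
rewrite /kernel_op !mulr_sumr -big_split/=.
by apply: eq_bigr => y _; ring.
Qed.

Definition dirichlet_kernel (R : realType) (V : choiceType) (e : rel V)
    (a : V -> V -> R) (q : V -> R) (A : {fset V}) (x y : A) : R :=
  (x == y)%:R * (1 + q (val x)) - (deg e (val x))%:R^-1 * a (val x) (val y).

Lemma dirichlet_kernelE (R : realType) (V : choiceType) (e : rel V)
    (a : V -> V -> R) (q : V -> R) (A : {fset V}) :
  jacobi_coeffs e a q ->
  @dirichlet R V e a q A = kernel_op (@dirichlet_kernel R V e a q A).
Proof.
move=> [_ _ _ aN]; apply/funext => f; apply/funext => x.
rewrite /kernel_op /dirichlet_kernel.
under eq_bigr do rewrite mulrBl -mulrA -[X in _ - X]mulrA.
rewrite sumrB sum_delta_mul -mulr_sumr.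
rewrite /dirichlet big_mkcond/= mulrDl mul1r addrAC; congr (_ + _ - _ * _).
by apply: eq_bigr => y _; case: ifPn => // /aN ->; rewrite mul0r.
Qed.

Lemma dirichlet_kernel_sym (R : realType) (V : choiceType) (e : rel V)
    (a : V -> V -> R) (q : V -> R) (A : {fset V}) (x y : A) :
  jacobi_coeffs e a q -> (forall x, 0 < deg e x)%N ->
  (deg e (val x))%:R * dirichlet_kernel e a q x y =
  (deg e (val y))%:R * dirichlet_kernel e a q y x.
Proof.
move=> [_ aC _ _] deg0.
have d0 w : (deg e w)%:R != 0 :> R by rewrite pnatr_eq0 -lt0n.
rewrite /dirichlet_kernel !mulrBr !mulVKf// (aC (val x)); congr (_ - _).
by rewrite eq_sym; case: eqVneq => [->|]//; rewrite !mul0r !mulr0.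
Qed.

Lemma dirichlet_kernel_le0 (R : realType) (V : choiceType) (e : rel V)
    (a : V -> V -> R) (q : V -> R) (A : {fset V}) (x y : A) :
  jacobi_coeffs e a q -> x != y -> dirichlet_kernel e a q x y <= 0.
Proof.
move=> [_ _ a01 aN] /negbTE xy; rewrite /dirichlet_kernel xy mul0r sub0r oppr_le0.
rewrite mulr_ge0 ?invr_ge0//.
by have [/a01/andP[]|/aN ->] := boolP (e (val x) (val y)).
Qed.

(** The row sum is the Jacobi operator applied at [x] to the indicator of [A]: each neighbour
    contributes [1 - a] or 1, both nonnegative, and the potential remains. *)
Lemma dirichlet_kernel_rowsum (R : realType) (V : choiceType) (e : rel V)
    (a : V -> V -> R) (q : V -> R) (A : {fset V}) (x : A) :
  jacobi_coeffs e a q -> finite_set (nbhd_set e (val x)) ->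
  (0 < deg e (val x))%N ->
  q (val x) <= \sum_y dirichlet_kernel e a q x y.
Proof.
move=> co finx deg0.
have -> : \sum_y dirichlet_kernel e a q x y = dirichlet e a q (fun=> 1) x.
  by rewrite dirichlet_kernelE//; apply: eq_bigr => y _; rewrite mulr1.
have [_ _ a01 aN] := co.
have ext1 : zero_ext ((fun=> 1) : A -> R) (val x) = 1 by rewrite /zero_ext valK.
rewrite dirichletE// /jacobi ext1 mulr1 lerDr mulr_ge0 ?invr_ge0//.
rewrite big_seq sumr_ge0// => y; rewrite in_fset_set// inE => /a01/andP[_ a1].
rewrite /zero_ext; case: insub => [w|]; rewrite ?mulr0 ?subr0// mulr1.
by rewrite subr_ge0.
Qed.

(** A positive maximum [F] of the zero extension would spread to neighbours and, by connectedness,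
    to all of the infinite set [V], whereas the extension vanishes off the finite set [A]. *)
Lemma dirichlet_maximum_principle (R : realType) (V : choiceType) (e : rel V)
    (a : V -> V -> R) (q : V -> R) (A : {fset V}) (f : A -> R) :
  jacobi_coeffs e a q -> (forall x, finite_set (nbhd_set e x)) ->
  (forall x, 0 < deg e x)%N -> connected_graph e -> infinite_set [set: V] ->
  (forall x, 0 < f x -> dirichlet e a q f x <= 0) -> forall x, f x <= 0.
Proof.
move=> [q0 _ a01 _] fin deg0 conn infV fP x; rewrite leNgt; apply/negP => fx.
have [x1 _ maxf] := @arg_maxP _ _ _ x predT f isT.
set F := f x1 in maxf; have F0 : 0 < F by apply: lt_le_trans (maxf x isT).
have gF y : zero_ext f y <= F.
  by rewrite /zero_ext; case: insub => [w|]; [exact: maxf|exact: ltW].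
have step y z : zero_ext f y = F -> e y z -> zero_ext f z = F.
  move=> gy yz.
  have [w wy] : exists w : A, val w = y.
    by move: gy; rewrite /zero_ext; case: insubP => [w _ <-|_ E]; [exists w|
      rewrite -E ltxx in F0].
  have fw : f w = F by move: gy; rewrite -wy /zero_ext valK.
  have := fP w; rewrite fw => /(_ F0); rewrite dirichletE// /jacobi wy gy.
  move=> H.
  (* Nonnegative terms with a nonpositive sum are each nonpositive; as [a <= 1], the value at the
     neighbour [z] cannot be below [F]. *)
  have termge0 t : t \in fset_set (nbhd_set e y) -> 0 <= F - a y t * zero_ext f t.
    rewrite in_fset_set// inE => /a01/andP[a0 a1]; rewrite subr_ge0.
    apply: (@le_trans _ _ (a y t * F)); first exact: ler_wpM2l.
    by rewrite ler_piMl// ltW.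
  have S0 : \sum_(t <- fset_set (nbhd_set e y)) (F - a y t * zero_ext f t) <= 0.
    have H2 : (deg e y)%:R^-1 * \sum_(t <- fset_set (nbhd_set e y))
        (F - a y t * zero_ext f t) <= 0.
      by apply: le_trans H; rewrite lerDl mulr_ge0// ltW.
    by move: H2; rewrite pmulr_rle0// invr_gt0 ltr0n.
  have zN : z \in fset_set (nbhd_set e y) by rewrite in_fset_set// inE.
  have : F - a y z * zero_ext f z <= 0.
    apply: le_trans S0; rewrite (big_fsetD1 z)//= lerDl.
    rewrite big_seq sumr_ge0// => t; rewrite in_fsetD => /andP[_]; exact: termge0.
  rewrite subr_le0 => Fa; have /andP[a0 a1] := a01 _ _ yz.
  apply/eqP; rewrite eq_le gF/= leNgt; apply/negP => gz.
  have az : 0 < a y z.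
    by rewrite lt_neqAle a0 andbT; apply: contraTneq Fa => <-; rewrite mul0r -ltNge.
  have := le_lt_trans Fa; rewrite -(ltr_pM2l az) in gz => /(_ _ gz).
  by rewrite -subr_lt0 -{1}[F]mul1r -mulrBl pmulr_llt0// subr_lt0 ltNge a1.
have walk y : zero_ext f y = F.
  have [n [p [pth <- _]]] := conn (val x1) y.
  have : zero_ext f (val x1) = F by rewrite /zero_ext valK.
  elim: p (val x1) pth => //= v p IH w /andP[wv pth] gw.
  by apply: IH => //; exact: step wv.
apply: infV; apply: (@sub_finite_set _ _ [set` A]); last exact: finite_fset.
move=> y _ /=; have := walk y; rewrite /zero_ext; case: insubP => // _ E.
by rewrite -E ltxx in F0.
Qed.

(** * Comparison of the landscape function with the ground state energy *)

(** Positivity: if [lam <= 0], the maximum principle applies to an eigenfunction and to its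
    negative, so both vanish. *)
Lemma dirichlet_spectrum (R : realType) (V : choiceType) (e : rel V)
    (a : V -> V -> R) (q : V -> R) (A : {fset V}) :
  jacobi_coeffs e a q -> (forall x, finite_set (nbhd_set e x)) ->
  (forall x, 0 < deg e x)%N -> connected_graph e -> infinite_set [set: V] ->
  A != fset0 ->
  let lam := smallest_eigenvalue (@dirichlet R V e a q A) in
  exists (J : finType) (psi : J -> A -> R) (l : J -> R),
  [/\ eigenframe (fun x => (deg e (val x))%:R) (@dirichlet_kernel R V e a q A) psi l,
      forall j, (exists w, psi j w != 0) -> lam <= l j,
      op_eigenvalue (@dirichlet R V e a q A) lam & 0 < lam].
Proof.
move=> co fin deg0 conn infV /fset0Pn[x0 x0A] lam.
pose h := @dirichlet_kernel R V e a q A.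
pose m (x : A) : R := (deg e (val x))%:R.
have symh x y : m x * h x y = m y * h y x by exact: dirichlet_kernel_sym.
have m0 x : 0 < m x by rewrite ltr0n.
have [J [psi [l fr]]] := weighted_eigenframe m0 symh.
have [eig lamP] := smallest_eigenvalueP [` x0A]%fset symh fr.
rewrite -(dirichlet_kernelE _ co) -/lam in eig lamP.
exists J, psi, l; split=> //.
rewrite ltNge; apply/negP => lam0.
have [f [[w fw] fE]] := eig.
have Mx (g : A -> R) :
    (forall x, dirichlet e a q g x = lam * g x) -> forall x, g x <= 0.
  move=> gE; apply: (dirichlet_maximum_principle co) => // x gx.
  by rewrite gE mulr_le0_ge0// ltW.
have f1 := Mx f fE w.
have f2 : - f w <= 0.
  apply: (Mx (fun x => - f x)) => x; rewrite mulrN -fE dirichlet_kernelE//.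
  by rewrite /kernel_op -sumrN; apply: eq_bigr => y _; rewrite mulrN.
by move: fw; rewrite eq_le f1 -oppr_le0 f2.
Qed.

Lemma landscapeP (R : realType) (V : choiceType) (e : rel V)
    (a : V -> V -> R) (q : V -> R) (A : {fset V}) :
  jacobi_coeffs e a q -> (forall x, finite_set (nbhd_set e x)) ->
  (forall x, 0 < deg e x)%N -> connected_graph e -> infinite_set [set: V] ->
  A != fset0 -> forall x, dirichlet e a q (@landscape R V e a q A) x = 1.
Proof.
move=> co fin deg0 conn infV A0.
have [J [psi [l [fr lamP _ lam0]]]] := dirichlet_spectrum co fin deg0 conn infV A0.
apply: (@xgetPex _ (fun=> 0) [set u : A -> R | forall x, dirichlet e a q u x = 1]).
(* The inverse operator applied to 1, in spectral form; an uncontrolled [(l j)^-1] only meets a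
   vanishing [psi j]. *)
exists (fun x => \sum_j
  ((l j)^-1 * frame_coef (fun x => (deg e (val x))%:R) psi (fun=> 1) j)
    * psi j x) => x.
rewrite (dirichlet_kernelE _ co) kernel_op_sum [RHS](frame_expand (fun=> 1) x fr).
apply: eq_bigr => j _; rewrite fr.1.
have [[w pw]|/forallNP psi0] := pselect (exists w, psi j w != 0).
  have lj : l j != 0 by rewrite gt_eqF// (lt_le_trans lam0)// lamP//; exists w.
  by rewrite mulrACA mulVf// mul1r.
by have /negP/negPn/eqP -> := psi0 x; rewrite !mulr0.
Qed.

Lemma dirichlet_nonneg (R : realType) (V : choiceType) (e : rel V)
    (a : V -> V -> R) (q : V -> R) (A : {fset V}) (f : A -> R) :
  jacobi_coeffs e a q -> (forall x, finite_set (nbhd_set e x)) ->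
  (forall x, 0 < deg e x)%N -> connected_graph e -> infinite_set [set: V] ->
  (forall x, 0 <= dirichlet e a q f x) -> forall x, 0 <= f x.
Proof.
move=> co fin deg0 conn infV f0 x; rewrite -oppr_le0.
apply: (dirichlet_maximum_principle (f := fun x => - f x) co) => // y _.
rewrite dirichlet_kernelE// /kernel_op.
under eq_bigr do rewrite mulrN.
by rewrite sumrN oppr_le0; have := f0 y; rewrite dirichlet_kernelE.
Qed.

Lemma eigenvalue_mul_landscape_ge1 (R : realType) (V : choiceType) (e : rel V)
    (a : V -> V -> R) (q : V -> R) (A : {fset V}) (lam : R) :
  jacobi_coeffs e a q -> (forall x, finite_set (nbhd_set e x)) ->
  (forall x, 0 < deg e x)%N -> connected_graph e -> infinite_set [set: V] ->
  A != fset0 -> 0 < lam -> op_eigenvalue (@dirichlet R V e a q A) lam ->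
  1 <= lam * sup_norm (@landscape R V e a q A).
Proof.
move=> co fin deg0 conn infV A0 lam0 [f [[w fw] fE]].
have uP := landscapeP co fin deg0 conn infV A0.
set u := @landscape R V e a q A in uP *.
have F0 : 0 < sup_norm f by apply: lt_le_trans (le_sup_norm f w); rewrite normr_gt0.
set F := sup_norm f in F0.
(* Here [s] is either sign; the operator sends [lam * F * u - s * f] to [lam * (F - s * f)], which
   is nonnegative. *)
have cmp (s : R) x : s * s = 1 -> s * f x <= lam * F * u x.
  move=> s1; rewrite -subr_ge0 -mulNr.
  apply: (dirichlet_nonneg (f := fun x => lam * F * u x + - s * f x) co) => // y.
  rewrite (dirichlet_kernelE _ co) kernel_op_lin -!(dirichlet_kernelE _ co) uP fE.
  rewrite mulr1 mulrCA -mulrDr; apply: mulr_ge0; first exact: ltW.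
  rewrite mulNr subr_ge0.
  apply: le_trans (le_sup_norm f y); rewrite -[leRHS]mul1r.
  have /eqP : s ^+ 2 = 1 by rewrite expr2.
  rewrite sqrf_eq1 => /orP[]/eqP->; rewrite ?mul1r ?mulN1r ?ler_norm//.
  by rewrite -normrN ler_norm.
suff : F <= lam * sup_norm u * F by rewrite ler_pMl.
apply: sup_norm_le => [|x].
  apply: mulr_ge0 (ltW F0); apply: mulr_ge0 (ltW lam0) _.
  exact: le_trans (normr_ge0 _) (le_sup_norm u w).
apply: (@le_trans _ _ (lam * F * u x)).
  rewrite ler_norml lerNl -mulN1r cmp ?mulrNN ?mulr1//= -[f x]mul1r cmp//.
  by rewrite mulr1.
rewrite mulrAC; apply: (ler_wpM2r (ltW F0)); apply: (ler_wpM2l (ltW lam0)).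
by apply: le_trans (le_sup_norm u x); exact: ler_norm.
Qed.

(** The hypotheses give [q >= lam / 2] on [A], so by the row sum bound the constant [2 / lam] is a
    supersolution. *)
Lemma landscape_large_eigenvalue (R : realType) (V : choiceType) (e : rel V)
    (a : V -> V -> R) (q : V -> R) (A : {fset V}) (lam : R) :
  jacobi_coeffs e a q -> (forall x, finite_set (nbhd_set e x)) ->
  (forall x, 0 < deg e x)%N -> connected_graph e -> infinite_set [set: V] ->
  A != fset0 -> 2 <= lam -> (forall x : A, lam <= 1 + q (val x)) ->
  forall x, @landscape R V e a q A x <= 2 / lam.
Proof.
move=> co fin deg0 conn infV A0 lam2 lamq x; rewrite -subr_ge0.
have uP := landscapeP co fin deg0 conn infV A0.
set u := @landscape R V e a q A in uP *.
have lam0 : 0 < lam by lra.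
suff H : forall y, 0 <= dirichlet e a q (fun y => 2 / lam * 1 + -1 * u y) y.
  by have := dirichlet_nonneg co fin deg0 conn infV H x; rewrite mulr1 mulN1r.
move=> y; rewrite (dirichlet_kernelE _ co).
rewrite (kernel_op_lin _ _ _ (fun=> 1)).
rewrite -[X in _ + _ * X](congr1 (fun L => L u y) (dirichlet_kernelE A co)).
rewrite uP mulN1r subr_ge0.
have -> : kernel_op (dirichlet_kernel e a q (A:=A)) (fun=> 1) y =
    \sum_w dirichlet_kernel e a q y w by apply: eq_bigr => w _; rewrite mulr1.
have := dirichlet_kernel_rowsum co (fin (val y)) (deg0 (val y)).
have := lamq y => h1 h2.
rewrite mulrAC ler_pdivlMr// mul1r; lra.
Qed.

(* With [T = r^2 / rho^2], every entry of the heat kernel at time [T] is at most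
   [delta r^(-z) (k + 1)^(-N)] on the [k]-th shell of width [r]: spectral decay
   handles [k = 0], the Gaussian and exponential tails the others. *)
Lemma landscape_le_time (R : realType) (V : choiceType) (e : rel V)
    (a : V -> V -> R) (q : V -> R) (A : {fset V}) (CU z M c1 c2 c3 c4 c5 : R)
    (lam rho delta : R) (N r : nat) :
  0 < c1 -> 0 < c2 -> 0 < c3 -> 0 < c4 ->
  jacobi_coeffs e a q -> (forall x, finite_set (nbhd_set e x)) ->
  (forall x, 0 < deg e x)%N -> (forall x, (deg e x)%:R <= M) ->
  connected_graph e -> infinite_set [set: V] -> A != fset0 ->
  volume_growth e CU z -> heat_kernel_bound e a q z c1 c2 c3 c4 c5 ->
  lam = smallest_eigenvalue (@dirichlet R V e a q A) ->
  1 <= rho -> (0 < r)%N -> 0 <= CU -> z + 2 <= N%:R ->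
  0 <= delta -> delta * CU <= 4^-1 ->
  let T := (r%:R / rho) ^+ 2 in
  M * c5 * 2^-1 `^ (- (z / 2)) * rho `^ z * expR (- (lam * T / 2)) <= delta ->
  (forall k, (0 < k)%N ->
     c1 * rho `^ z * expR (- (c2 * (k%:R * rho))) <= delta * ((k.+1)%:R^-1) ^+ N) ->
  (forall k, (0 < k)%N ->
     c3 * r%:R `^ z * expR (- (c4 * (k%:R * r%:R))) <= delta * ((k.+1)%:R^-1) ^+ N) ->
  sup_norm (@landscape R V e a q A) <= 2 * T.
Proof.
move=> c10 c20 c30 c40 co fin deg0 degM conn infV A0 vol heat lamE rho1 r0 CU0.
move=> zN d0 dCU T near far1 far2.
have [J [psi [l [fr lamP eig lam0]]]] := dirichlet_spectrum co fin deg0 conn infV A0.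
rewrite -lamE in lamP eig lam0.
have uP := landscapeP co fin deg0 conn infV A0.
set u := @landscape R V e a q A in uP *.
have u0 : forall x, 0 <= u x.
  by apply: (dirichlet_nonneg co) => // x; rewrite uP.
have rp : 0 < r%:R :> R by rewrite ltr0n.
have rhop : 0 < rho by lra.
have T0 : 0 < T by rewrite exprn_gt0// divr_gt0.
have rzp : 0 < r%:R `^ z :> R by rewrite powR_gt0.
(* The resulting [r^(-z)] is what cancels the volume of a ball of radius [r]. *)
have Tz : T `^ (- (z / 2)) = rho `^ z / r%:R `^ z.
  have rr0 : 0 <= r%:R / rho by rewrite divr_ge0 ?ltW.
  have -> : - (z / 2) = 2^-1 * - z by field.
  rewrite powRrM powR12_sqrt ?ltW// sqrtr_sqr ger0_norm//.
  rewrite powRM ?invr_ge0 ?(ltW rhop)//.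
  by rewrite -(powR_inv1 (ltW rhop)) -powRrM mulN1r opprK powRN mulrC.
have heatE s : (fun (f : A -> R) w => - s * dirichlet e a q f w) =
    kernel_op (fun x y => - s * dirichlet_kernel e a q x y).
  apply/funext => f; apply/funext => w.
  rewrite (dirichlet_kernelE _ co) /kernel_op mulr_sumr.
  by apply: eq_bigr => y _; rewrite mulrA.
have heatB x y :
    mxel (exp_op (kernel_op (fun x y : A => - T * dirichlet_kernel e a q x y))) x y
    <= delta / r%:R `^ z * ((gdist e (val x) (val y) %/ r).+1%:R^-1) ^+ N.
  set d := gdist e (val x) (val y).
  (* On shell 0 the diagonal bound is taken at time [T / 2], whence the power of [2^-1] in
     [near]. *)
  have [k0|k0] := posnP (d %/ r)%N.
    rewrite k0 invr1 expr1n mulr1.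
    have mM (w : A) : 1 <= ((deg e (val w))%:R : R) <= M by rewrite ler1n deg0 degM.
    have half w : mxel (exp_op (kernel_op (fun x y : A =>
        - (T / 2) * dirichlet_kernel e a q x y))) w w <= c5 * (T / 2) `^ (- (z / 2)).
      rewrite -heatE; have := heat A (T / 2) w w; rewrite eqxx; apply.
      by rewrite divr_gt0.
    apply: (le_trans (heat_kernel_spectral_decay x y fr lamP (ltW T0) mM half)).
    rewrite powRM ?invr_ge0 ?(ltW T0)// Tz ler_pdivlMr//.
    apply: le_trans near; rewrite le_eqVlt; apply/orP; left; apply/eqP.
    by field; rewrite gt_eqF.
  have xy : (x == y) = false.
    by apply: negbTE; apply: contraTneq k0 => xy; rewrite /d xy gdistxx div0n.
  have := heat A T x y T0; rewrite xy heatE => /le_trans; apply.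
  have dr : (d %/ r)%:R * r%:R <= d%:R :> R by rewrite -natrM ler_nat leq_divM.
  set k := (d %/ r)%N in k0 dr *.
  have k1 : 1 <= k%:R :> R by rewrite ler1n.
  (* Here [d^2 / T >= (k rho)^2 >= k rho], as [k] and [rho] are at least 1, so the Gaussian lies
     below the exponential profile of [far1]. *)
  case: ifP => _.
    rewrite Tz [leRHS]mulrAC ler_pdivlMr//.
    apply: le_trans (far1 k k0).
    rewrite [leLHS](_ : _ = c1 * rho `^ z * expR (- (c2 * d%:R ^+ 2 / T)));
      last by field; rewrite gt_eqF.
    rewrite ler_wpM2l ?(mulr_ge0 (ltW _) (powR_ge0 _ _))//.
    rewrite ler_expR lerN2 -mulrA ler_pM2l//.
    rewrite ler_pdivlMr// /T.
    apply: le_trans (_ : (k%:R * r%:R) ^+ 2 <= _); last first.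
      by apply: lerXn2r; rewrite ?nnegrE ?mulr_ge0.
    rewrite [leLHS](_ : _ = k%:R / rho * r%:R ^+ 2); last by field; rewrite gt_eqF.
    rewrite exprMn ler_wpM2r ?sqr_ge0// ler_pdivrMr// expr2 -mulrA ler_peMr//.
    by rewrite mulr_ege1.
  rewrite [leRHS]mulrAC ler_pdivlMr//.
  apply: le_trans (far2 k k0); rewrite mulrAC.
  by rewrite ler_wpM2l ?(mulr_ge0 (ltW _) (powR_ge0 _ _))// ler_expR lerN2 ler_pM2l.
have ball (x : A) n : (0 < n)%N ->
    #|[pred y : A | (gdist e (val x) (val y) <= n)%N]|%:R <= CU * n%:R `^ z.
  move=> n0; have [finB] := counting_leP (vol (val x) n n0).
  apply: le_trans; rewrite ler_nat.
  rewrite cardE -(size_map val); apply: uniq_leq_size.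
    by rewrite map_inj_uniq ?enum_uniq//; exact: val_inj.
  by move=> _ /mapP[y + ->]; rewrite mem_enum inE => dy; rewrite in_fset_set// inE.
have U0 : 0 <= sup_norm u.
  have [_ [[w _] _]] := eig; exact: le_trans (normr_ge0 _) (le_sup_norm u w).
(* The half comes from [2 * delta * CU <= 1/2], once [r^z] from the shell sum cancels [r^(-z)] from
   the kernel bound. *)
have U2 x : u x <= T + sup_norm u / 2.
  rewrite -lerBlDl.
  have h1 (y : A) : \sum_w dirichlet_kernel e a q y w >= 0.
    by apply: le_trans (dirichlet_kernel_rowsum co (fin _) (deg0 _)); case: co.
  have h2 y : kernel_op (@dirichlet_kernel R V e a q A) u y = 1.
    by rewrite -(dirichlet_kernelE _ co).
  have h3 (y w : A) : y != w -> dirichlet_kernel e a q y w <= 0.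
    exact: dirichlet_kernel_le0.
  apply: (le_trans (heat_flow_lower_bound x fr h3 h1 h2 (ltW T0))).
  rewrite (exp_op_mxel _ _ (eigenframe_scale (- T) fr)).
  pose w (y : A) : R := ((gdist e (val x) (val y) %/ r).+1%:R^-1) ^+ N.
  apply: (@le_trans _ _ (\sum_y (delta / r%:R `^ z * sup_norm u) * w y)).
    apply: ler_sum => y _; apply: (le_trans (ler_wpM2r (u0 y) (heatB x y))).
    rewrite mulrAC ler_wpM2r ?exprn_ge0 ?invr_ge0// ler_wpM2l ?divr_ge0 ?powR_ge0//.
    exact: le_trans (ler_norm _) (le_sup_norm u y).
  rewrite -mulr_sumr.
  have c0 : 0 <= delta / r%:R `^ z * sup_norm u.
    by rewrite mulr_ge0// divr_ge0// powR_ge0.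
  apply: (le_trans (ler_wpM2l c0 (sum_shell_weight_le CU0 r0 zN (ball x)))).
  rewrite [leLHS](_ : _ = 2 * (delta * CU) * sup_norm u); last by field; rewrite gt_eqF.
  by rewrite [leRHS]mulrC ler_wpM2r//; lra.
suff : sup_norm u <= T + sup_norm u / 2 by lra.
apply: sup_norm_le => [|x]; last by rewrite ger0_norm.
by rewrite addr_ge0 ?divr_ge0// ltW.
Qed.

(** * Choice of the constants and of the time scale *)

Theorem theorem1 (R : realType) (CU z M c1 c2 c3 c4 c5 : R) :
  0 < c1 -> 0 < c2 -> 0 < c3 -> 0 < c4 -> 0 < c5 ->
  exists C : R,
    forall (V : choiceType) (e : rel V) (a : V -> V -> R) (q : V -> R),
      symmetric e -> irreflexive e -> connected_graph e ->
      countable [set: V] -> infinite_set [set: V] ->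
      sup_deg R e = M%:E ->
      jacobi_coeffs e a q ->
      volume_growth e CU z ->
      heat_kernel_bound e a q z c1 c2 c3 c4 c5 ->
      forall A : {fset V}, A != fset0 ->
        1 <= smallest_eigenvalue (@dirichlet R V e a q A)
             * sup_norm (@landscape R V e a q A) <= C.
Proof.
move=> c10 c20 c30 c40 c50.
(* The aim is [delta * CU <= 1/4]; [CU >= 1] is learned only from a graph, so the maximum keeps
   [delta] positive until then. *)
pose delta := (4 * Num.max 1 CU)^-1.
have max0 : 0 < Num.max 1 CU by rewrite lt_max ltr01.
have delta0 : 0 < delta by rewrite invr_gt0 mulr_gt0.
have [N zN] : exists N : nat, z + 2 <= N%:R.
  exists (Num.bound `|z + 2|); apply: le_trans (ler_norm _) _.
  by apply/ltW; exact: archi_boundP.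
have zN' : z <= N%:R by lra.
have [rho rho1 rhoP] := shell_profile_small (ltW c10) c20 delta0 zN'.
have [X2 X21 X2P] := shell_profile_small (ltW c30) c40 delta0 zN'.
(* The absolute value is there because [M >= 0] is also learned only from a graph. *)
pose b := `|M| * c5 * 2^-1 `^ (- (z / 2)) * rho `^ z.
have b0 : 0 <= b by rewrite !mulr_ge0 ?powR_ge0// ltW.
have half0 : 0 < 2^-1 :> R by rewrite invr_gt0.
have [X3 X31 X3P] := expr_expRN_small 0 b0 half0 delta0.
(* [K] is the target lower bound for [lam * T]: [X3] serves the spectral decay, and [2 * X2 ^+ 2]
   forces [r >= X2] when [lam < 2]. *)
pose K := Num.max X3 (2 * X2 ^+ 2).
have KX3 : X3 <= K by rewrite le_max lexx.
have KX2 : 2 * X2 ^+ 2 <= K by rewrite le_max lexx orbT.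
have rho0 : 0 < rho by lra.
(* After rounding, [2 * lam * T <= 4 * K + 4 * lam], and [lam < 2] in that case. *)
exists (4 * K + 8) => V e a q syme irre conn _ infV supM co vol heat A A0.
have fin x : finite_set (nbhd_set e x) by case: (sup_deg_le x supM).
have degM x : (deg e x)%:R <= M by case: (sup_deg_le x supM).
have deg0 x : (0 < deg e x)%N by exact: deg_gt0.
have [J [psi [l [fr lamP eig lam0]]]] := dirichlet_spectrum co fin deg0 conn infV A0.
set lam := smallest_eigenvalue _ in lamP eig lam0 *.
apply/andP; split; first exact: (eigenvalue_mul_landscape_ge1 co).
have [x0 x0A] := fset0Pn _ A0.
have lamq (x : A) : lam <= 1 + q (val x).
  apply: le_trans
    (@smallest_eigenvalue_le_diag _ _ _ _ _ _ _ lam x (ler0n _ _) fr lamP) _.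
  rewrite /dirichlet_kernel eqxx mul1r lerBlDr lerDl.
  by have [_ _ _ aN] := co; rewrite aN ?irre// mulr0.
have M0 : 0 <= M by apply: le_trans (degM x0).
have CU1 : 1 <= CU.
  have := counting_leP (vol x0 1%N isT); rewrite powR1 mulr1 => -[finB].
  apply: le_trans; rewrite ler1n cardfs_gt0; apply/fset0Pn; exists x0.
  by rewrite in_fset_set// inE /= gdistxx.
have [lam2|lam2] := leP 2 lam.
  apply: (@le_trans _ _ 2); last by have := sqr_ge0 X2; lra.
  rewrite mulrC -ler_pdivlMr//; apply: sup_norm_le => [|x].
    by rewrite divr_ge0// ltW.
  rewrite ger0_norm; first exact: (landscape_large_eigenvalue co).
  by apply: (dirichlet_nonneg co) => // y; rewrite (landscapeP co).
(* At the real radius [y] the time [(y / rho)^2] equals [K / lam]; rounding up to [r] ensures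
   [lam * T >= K]. *)
pose y := rho * Num.sqrt (K / lam).
have K0 : 0 <= K by lra.
have sK : Num.sqrt (K / lam) ^+ 2 = K / lam by rewrite sqr_sqrtr// divr_ge0// ltW.
set s := Num.sqrt (K / lam) in y sK *.
have s0 : 0 <= s by exact: sqrtr_ge0.
have y0 : 0 <= y by rewrite mulr_ge0// ltW.
pose r := (Num.truncn y).+1.
have /andP[ry yr] : r%:R - 1 <= y < r%:R.
  by have := truncn_itv y0; rewrite -natr1 addrK.
have lamK : lam * s ^+ 2 = K by rewrite sK mulrC divfK ?gt_eqF.
have sr : s <= r%:R / rho by rewrite ler_pdivlMr// mulrC ltW.
have Xr : X2 <= r%:R.
  apply: le_trans (ltW yr); apply: (@le_trans _ _ s); last by rewrite ler_peMl.
  rewrite -(@ler_pXn2r _ 2%N) ?nnegrE//; last by lra.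
  by rewrite sK ler_pdivlMr//; have := sqr_ge0 X2; nra.
have := @landscape_le_time R V e a q A CU z M c1 c2 c3 c4 c5 lam rho delta N r
  c10 c20 c30 c40 co fin deg0 degM conn infV A0 vol heat erefl rho1 isT _ zN
  (ltW delta0).
set T := (r%:R / rho) ^+ 2.
have TK : K <= lam * T.
  rewrite -lamK ler_pM2l//; apply: lerXn2r; rewrite ?nnegrE//.
  by rewrite divr_ge0// ltW.
move=> /(_ _ _ _ (fun k => rhoP rho k (lexx _)) (fun k => X2P r%:R k Xr)) H.
apply: (@le_trans _ _ (lam * (2 * T))).
  rewrite ler_pM2l//; apply: H; first by lra.
    by rewrite /delta max_r// invfM -mulrA mulVf ?mulr1// gt_eqF// (lt_le_trans ltr01).
  apply: le_trans (X3P K KX3); rewrite expr0 mulr1 /b ger0_norm//.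
  apply: ler_wpM2l; first by rewrite !mulr_ge0 ?powR_ge0// ltW.
  by rewrite ler_expR; lra.
(* Rounding increases [s] by at most [1 / rho <= 1]. *)
have Ts : T <= 2 * s ^+ 2 + 2.
  apply: (@le_trans _ _ ((s + 1) ^+ 2)); last by have := sqr_ge0 (s - 1); nra.
  apply: lerXn2r; rewrite ?nnegrE; [by rewrite divr_ge0// ltW|lra|].
  by rewrite ler_pdivrMr//; move: ry; rewrite /y; lra.
by have := ler_wpM2l (ltW lam0) Ts; lra.
Qed.
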